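(* Let $(Z_n)_{n\geq 0}$ be a martingale of bounded real random variables with respect to a filtration $(\mathcal{F}_n)_{n\geq 0}$ on a probability space $(\Omega, \mathcal{F}, \mathbb{P})$ with $Z_0 = 0$. Let $\alpha>0$ and suppose that $-\alpha \leq dZ_n \leq \alpha$ for all $n\geq 1$. Then for each $c > 0$ there exists an integer $i\geq 1$ such that for every positive integer $m$ $$\mathbb{P}(Z_n \geq nc \text{ for some } n\geq m+i)\leq \exp\left\{\frac{-mc^2}{2 \alpha^2}\right\}.$$
   Context: $dZ_n=Z_n-Z_{n-1}$ denotes the martingale difference for $n\ge 1$. Being a martingale means that $Z_n$ is $\mathcal{F}_n$-measurable and $\mathbb{E}(Z_{n+1}\mid\mathcal{F}_n)=Z_n$ for all $n\geq 0$. *)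

(* Defs.v *)
From HB Require Import structures.
From mathcomp Require Import all_boot all_order all_algebra.
From mathcomp Require Import all_classical all_reals all_analysis.

Set Implicit Arguments.
Unset Strict Implicit.
Unset Printing Implicit Defensive.

Import Order.TTheory GRing.Theory Num.Theory.
Import numFieldNormedType.Exports.

Local Open Scope classical_set_scope.
Local Open Scope ring_scope.

Definition filtration d (T : measurableType d) (F : nat -> set (set T)) : Prop :=
  [/\ forall n, sigma_algebra [set: T] (F n),
      forall n, F n `<=` @measurable d T
    & forall m n, (m <= n)%N -> F m `<=` F n].

(* When G is a sigma-algebra, the measurable sets of [g_sigma_algebraType G]
   are exactly the members of G. *)
Definition sub_measurable d (T : measurableType d) (R : realType)
    (G : set (set T)) (f : T -> R) : Prop :=
  measurable_fun [set: g_sigma_algebraType G]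
    (f : g_sigma_algebraType G -> R).

(* [is_cond_expectation P G X Y] : the random variable Y is a version of
   E(X | G).  Conditional expectations are only determined up to P-null sets,
   so an equation E(X | G) = Y is read as this relation. *)
Definition is_cond_expectation d (T : measurableType d) (R : realType)
    (P : probability T R) (G : set (set T)) (X Y : T -> R) : Prop :=
  [/\ P.-integrable [set: T] (EFin \o X),
      P.-integrable [set: T] (EFin \o Y),
      sub_measurable G Y
    & forall A, G A ->
        (\int[P]_(w in A) (Y w)%:E = \int[P]_(w in A) (X w)%:E)%E].

Definition martingale d (T : measurableType d) (R : realType)
    (P : probability T R) (F : nat -> set (set T))
    (Z : nat -> {RV P >-> R}) : Prop :=
  (forall n, sub_measurable (F n) (Z n)) /\
  (forall n, is_cond_expectation P (F n) (Z n.+1) (Z n)).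

(* Meaningful for n >= 1 only: at n = 0 it is the zero function. *)
Definition mart_diff d (T : measurableType d) (R : realType)
    (P : probability T R) (Z : nat -> {RV P >-> R}) (n : nat) (w : T) : R :=
  Z n w - Z n.-1 w.

(* Boundedness of a random variable is understood almost surely. *)
Definition bounded_rv d (T : measurableType d) (R : realType)
    (P : probability T R) (X : {RV P >-> R}) : Prop :=
  exists M : R, {ae P, forall w, `|X w| <= M}.

(* Main.v *)
Require Import Defs.
From HB Require Import structures.
From mathcomp Require Import all_boot all_order all_algebra.
From mathcomp Require Import all_classical all_reals all_analysis.
From mathcomp Require Import measurable_realfun ring lra.

(** The probability that [Z n >= n * c] for some [n >= m + i] is at most the
    sum of the individual probabilities, so it suffices that these decay
    geometrically.  This is the Azuma-Hoeffding inequality [azuma]: with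
    [q = exp (- c^2 / (2 alpha^2)) < 1] one has [P (Z n >= n * c) <= q^n].
    The tail sum [q^(m+i) / (1 - q)] is then at most [q^m], the required bound,
    as soon as [i] is so large that [q^i <= 1 - q].

    The Azuma-Hoeffding inequality comes from the Chernoff bound at
    [t = c / alpha^2] and from the estimate
    [E (exp (t Z_n)) <= exp (n t^2 alpha^2 / 2)] ([azuma_mmt_gen_fun]), proved
    by induction on [n].  In the inductive step [mmt_gen_fun_step], convexity
    bounds [exp (t dZ)] by its chord [L dZ] over [[- alpha, alpha]], an affine
    function of [dZ].  The martingale property says that [L dZ] has the same
    integral as the constant [L 0 = cosh (t alpha)] over every set of the
    sigma-algebra of the past, hence also
    after weighting by the past-measurable function [exp (t Z_n)]
    ([ge0_integral_weight_eq]).  Thus each step multiplies the moment generating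
    function by at most [cosh (t alpha)], and
    [cosh x <= exp (x^2 / 2)] ([expRD_expRN_le]).

    Since [L] is nonnegative on [[- alpha, alpha]], all weighted integrands can be
    taken nonnegative, so that the weighting lemma follows from monotone
    convergence alone. *)

Set Implicit Arguments.
Unset Strict Implicit.
Unset Printing Implicit Defensive.

Import Order.TTheory GRing.Theory Num.Theory.
Import numFieldNormedType.Exports.

Local Open Scope classical_set_scope.
Local Open Scope ring_scope.

Lemma derive_ge0_le0y (R : realType) (f df : R -> R) :
  (forall x : R, is_derive x 1 f (df x)) -> (forall x, 0 < x -> 0 <= df x) ->
  forall x, 0 <= x -> f 0 <= f x.
Proof.
move=> dfE df0 x x0.
apply: (@ger0_derive1_le_cc R f 0 x) => //; rewrite ?in_itv/= ?lexx ?x0//.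
- move=> y; rewrite ?in_itv/= => /andP[y0 _].
  by rewrite derive1E; case: (dfE y) => _ ->; exact: df0.
- by apply: derivable_within_continuous => y _; case: (dfE y).
Qed.

(** This is [cosh x <= exp (x^2 / 2)].  By evenness take [x >= 0]; then
    [2 cosh x * exp (- x^2 / 2)] equals 2 at the origin and decreases, because
    its derivative has the sign of [sinh x - x cosh x], which vanishes at 0 and
    has derivative [- x sinh x <= 0]. *)
Lemma expRD_expRN_le (R : realType) (x : R) :
  expR x + expR (- x) <= 2 * expR (x ^+ 2 / 2).
Proof.
wlog x0 : x / 0 <= x => [hw|].
  have [/hw//|/ltW x0] := leP 0 x.
  by rewrite addrC -{2}(opprK x) -(sqrrN x); apply: hw; rewrite oppr_ge0.
(* [k / 2] is [y cosh y - sinh y] and [h] is the opposite of the decreasing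
   function. *)
pose k (y : R) := y * (expR y + expR (- y)) - (expR y - expR (- y)).
have k0 y : 0 <= y -> 0 <= k y.
  move=> y0; rewrite [leLHS](_ : 0 = k 0); last by rewrite /k oppr0 expR0; ring.
  move: y y0; apply: (@derive_ge0_le0y _ k (fun y => y * (expR y - expR (- y)))) => z.
    by apply: is_derive_eq; rewrite /GRing.scale/=; ring.
  by move=> z0; rewrite mulr_ge0 ?ltW// subr_gt0 ltr_expR; lra.
pose h (y : R) := - ((expR y + expR (- y)) * expR (- (y * y / 2))).
have : h 0 <= h x.
  apply: (@derive_ge0_le0y _ h (fun y => k y * expR (- (y * y / 2)))) => // z.
    by apply: is_derive_eq; rewrite /GRing.scale/= /k; field.
  by move=> z0; rewrite mulr_ge0 ?expR_ge0// k0 ?ltW.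
rewrite /h mul0r mul0r oppr0 expR0 mulr1 lerN2 !expRN -expr2 => hx.
by rewrite -ler_pdivrMr ?expR_gt0.
Qed.

(** The exponential lies below its chord over [[- t a, t a]].  The graph lies
    above its tangent at [t x]; averaging the tangent inequalities at the two
    end points with the barycentric weights of [x] cancels the linear terms. *)
Lemma expR_le_chord (R : realType) (t a x : R) : 0 < a -> - a <= x <= a ->
  expR (t * x) <= expR (- (t * a))
     + (expR (t * a) - expR (- (t * a))) / (2 * a) * (x + a).
Proof.
move=> a0 /andP[ax xa].
have tangent y : expR (t * x) * (1 + (t * y - t * x)) <= expR (t * y).
  by rewrite -[t * y in leRHS](subrKC (t * x)) expRD ler_pM2l ?expR_gt0 ?expR_ge1Dx.
have := tangent a; have := tangent (- a); rewrite mulrN.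
set u := expR (t * x); set p := expR (t * a); set q := expR (- (t * a)).
move=> hq hp.
have -> : q + (p - q) / (2 * a) * (x + a)
    = (q * (a - x) + p * (x + a)) / (2 * a) by field; lra.
rewrite ler_pdivlMr; last lra.
have h1 := ler_wpM2r (_ : 0 <= a - x) hq; have h2 := ler_wpM2r (_ : 0 <= x + a) hp.
have {}h1 := h1 ltac:(lra); have {}h2 := h2 ltac:(lra).
apply: le_trans (lerD h1 h2).
by rewrite le_eqVlt; apply/orP; left; apply/eqP; ring.
Qed.

Section weighting.
(* Gives access to the simple functions that approximate the weight. *)
Import HBNNSimple.

(** Two nonnegative densities that agree on a sub-sigma-algebra [G] agree
    against every nonnegative [G]-measurable weight: the weight is an increasing
    limit of simple functions whose level sets lie in [G]. *)
Lemma ge0_integral_weight_eq (d : measure_display) (T : measurableType d)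
    (R : realType) (P : {measure set T -> \bar R}) (G : set (set T)) (f g : T -> R)
    (Y : T -> R) :
  sigma_algebra [set: T] G -> G `<=` @measurable d T ->
  measurable_fun [set: T] f -> measurable_fun [set: T] g ->
  (forall x, 0 <= f x) -> (forall x, 0 <= g x) ->
  (forall A, G A -> \int[P]_(x in A) (f x)%:E = \int[P]_(x in A) (g x)%:E)%E ->
  (forall x, 0 <= Y x) -> sub_measurable G Y ->
  (\int[P]_x ((Y x)%:E * (f x)%:E) = \int[P]_x ((Y x)%:E * (g x)%:E))%E.
Proof.
move=> sG GT mf mg f0 g0 fg Y0 mY.
have GE A : (@measurable _ (g_sigma_algebraType G) A) = G A.
  by rewrite /measurable/= sigma_algebra_id.
have mYE : measurable_fun [set: g_sigma_algebraType G]
    (EFin \o (Y : g_sigma_algebraType G -> R)) by apply/measurable_EFinP.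
pose h := nnsfun_approx (measurableT : measurable [set: g_sigma_algebraType G]) mYE.
have hG n y : G (h n @^-1` [set y]).
  suff: measurable (h n @^-1` [set y]) by rewrite GE.
  exact: measurable_funPTI.
have mh n y : @measurable d T (h n @^-1` [set y]) by apply: GT.
have mhn n y : measurable_fun [set: T] (fun x : T => (y * \1_(h n @^-1` [set y]) x)%:E).
  by apply/measurable_EFinP; apply: measurable_funM => //; exact: measurable_indic.
(* The right-hand side depends on [k] only through its integrals over members
   of [G]. *)
have key (k : T -> R) : measurable_fun [set: T] k -> (forall x, 0 <= k x) ->
   (\int[P]_x ((Y x)%:E * (k x)%:E) = limn (fun n =>
      \sum_(y \in range (h n)) (y%:E * \int[P]_(x in h n @^-1` [set y]) (k x)%:E)))%E.
  move=> mk k0.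
  have mEk : measurable_fun [set: T] (EFin \o k) by apply/measurable_EFinP.
  have Ek0 x : (0 <= (k x)%:E)%E by rewrite lee_fin.
  have hE n x : ((h n x)%:E * (k x)%:E =
     \sum_(y \in range (h n)) ((y * \1_(h n @^-1` [set y]) x)%:E * (k x)%:E))%E.
    rewrite fimfunE -fsumEFin// ge0_mule_fsuml// => y.
    exact: nnfun_muleindic_ge0.
  have mhk n y : measurable_fun [set: T]
      (fun x : T => (y * \1_(h n @^-1` [set y]) x)%:E * (k x)%:E)%E.
    by apply: emeasurable_funM.
  transitivity (\int[P]_x limn (fun n => (h n x)%:E * (k x)%:E)%E)%E.
    apply: eq_integral => x _; apply/esym/cvg_lim => //.
    apply: cvgeZr; first by [].
    apply: (cvg_nnsfun_approx measurableT mYE) => // z _; rewrite lee_fin; exact: Y0.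
  transitivity (limn (fun n => \int[P]_x ((h n x)%:E * (k x)%:E)))%E; last first.
    apply/congr_lim/funext => n.
    under eq_integral do rewrite hE.
    rewrite ge0_integral_fsum//; last first.
      by move=> y x _; rewrite mule_ge0//; exact: nnfun_muleindic_ge0.
    apply: eq_fsbigr => y; rewrite inE => -[z _ <-].
    under eq_integral do rewrite EFinM -muleA.
    rewrite ge0_integralZl_EFin//.
    + rewrite [in RHS]integral_mkcond; congr (_ * _)%E; apply: eq_integral => x _.
      by rewrite epatch_indic muleC.
    + by move=> x _; rewrite mule_ge0// lee_fin.
    + apply: emeasurable_funM => //.
      by apply/measurable_EFinP; exact: measurable_indic.
  apply: (@monotone_convergence _ _ _ P setT measurableT
    (fun n x => (h n x)%:E * (k x)%:E)%E).
  - move=> n; under eq_fun do rewrite hE.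
    by apply: emeasurable_fsum.
  - by move=> n x _; rewrite mule_ge0// lee_fin.
  - move=> x _ a b ab; rewrite lee_wpmul2r// lee_fin.
    by have /lefP := nd_nnsfun_approx measurableT mYE ab; exact.
rewrite !key//; apply/congr_lim/funext => n.
by apply: eq_fsbigr => y _; rewrite fg.
Qed.

End weighting.

Lemma geometric_tail_bound (d : measure_display) (T : measurableType d)
    (R : realType) (P : {measure set T -> \bar R}) (E : nat -> set T) (q : R) (N : nat) :
  0 < q < 1 -> (forall n, measurable (E n)) ->
  (forall n, (P (E n) <= (q ^+ n)%:E)%E) ->
  (P [set w | exists n, (N <= n)%N /\ E n w] <= (q ^+ N / (1 - q))%:E)%E.
Proof.
move=> /andP[q0 q1] mE PE.
have -> : [set w | exists n, (N <= n)%N /\ E n w] = \bigcup_n E (n + N)%N.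
  apply/seteqP; split => [w [n [Nn En]]|w [n _ En]].
    by exists (n - N)%N => //=; rewrite subnK.
  by exists (n + N)%N; rewrite leq_addl.
apply: (@le_trans _ _ (\sum_(0 <= k <oo) P (E (k + N)%N))%E).
  apply: measure_sigma_subadditive => //.
  by apply: bigcup_measurable => n _; exact: mE.
apply: lime_le; first by apply: is_cvg_nneseries.
apply: nearW => n.
apply: (@le_trans _ _ (\sum_(0 <= k < n) (geometric (q ^+ N) q k)%:E)%E).
  by apply: lee_sum => k _; rewrite /= -exprD addnC.
by rewrite sumEFin lee_fin geometric_le_lim ?ger0_norm ?exprn_ge0 ?ltW.
Qed.

(** One conditioning step: a centred increment with values in [[- a, a]]
    multiplies the moment generating function by at most [cosh (t a)], the value
    at 0 of the chord of [exp] over [[- t a, t a]]. *)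
Lemma mmt_gen_fun_step (d : measure_display) (T : measurableType d)
    (R : realType) (P : probability T R) (G : set (set T))
    (X Y : {RV P >-> R}) (a t : R) :
  sigma_algebra [set: T] G -> G `<=` @measurable d T ->
  is_cond_expectation P G X Y -> 0 < a -> 0 <= t ->
  {ae P, forall w, - a <= X w - Y w <= a} ->
  ('M_P X t <= ((expR (t * a) + expR (- (t * a))) / 2)%:E * 'M_P Y t)%E.
Proof.
move=> sG GT [iX iY mY XY] a0 t0 hd.
set kappa := (_ / 2).
pose s := (expR (t * a) - expR (- (t * a))) / (2 * a).
have kappa0 : 0 <= kappa by rewrite divr_ge0// addr_ge0// expR_ge0.
have s0 : 0 <= s.
  by rewrite divr_ge0 ?mulr_ge0 ?(ltW a0)// subr_ge0 ler_expR ge0_cp// mulr_ge0// ltW.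
(* [kappa + s * x] is the chord of [fun x => expR (t * x)] over [[- a, a]].  It
   is nonnegative where the increment obeys its bound; the absolute value makes
   [f] nonnegative everywhere without changing it almost surely. *)
pose f w := `|kappa + s * (X w - Y w)|.
have chord w : - a <= X w - Y w <= a -> expR (t * X w) <= expR (t * Y w) * f w.
  move=> hw; have -> : t * X w = t * Y w + t * (X w - Y w) by ring.
  rewrite expRD ler_pM2l ?expR_gt0// (le_trans (expR_le_chord t a0 hw))//.
  apply: le_trans (ler_norm _); rewrite le_eqVlt; apply/orP; left; apply/eqP.
  by rewrite /kappa /s; field; lra.
have mlin : measurable_fun [set: T] (fun w => kappa + s * (X w - Y w)).
  by apply: measurable_funD => //; apply: measurable_funM => //; exact: measurable_funB.
have mf : measurable_fun [set: T] f by exact: measurableT_comp.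
have f0 w : 0 <= f w by exact: normr_ge0.
have fG A : G A -> (\int[P]_(x in A) (f x)%:E = \int[P]_(x in A) kappa%:E)%E.
  move=> GA; have mA := GT _ GA.
  have iXA : P.-integrable A (EFin \o X) by exact: integrableS iX.
  have iYA : P.-integrable A (EFin \o Y) by exact: integrableS iY.
  have iD : P.-integrable A (fun w => (X w)%:E - (Y w)%:E)%E by exact: integrableB.
  have ic : P.-integrable A (cst kappa%:E) by exact: finite_measure_integrable_cst.
  transitivity (\int[P]_(x in A) (kappa%:E + s%:E * ((X x)%:E - (Y x)%:E)))%E.
    apply: ae_eq_integral => //.
    - by apply/measurable_EFinP; exact: measurable_funTS.
    - by apply: (measurable_funTS (measurableT_comp _ mlin)).
    - apply: filterS hd => w hw Aw; rewrite /f ger0_norm//.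
      have := ler_wpM2l s0 (andP hw).1.
      have -> : s * - a = - (expR (t * a) - expR (- (t * a))) / 2 by rewrite /s; field; lra.
      by rewrite /kappa; have := expR_ge0 (- (t * a)); lra.
  rewrite integralD//; last exact: integrableZl.
  rewrite integralZl// integralB_EFin// XY// subee ?mule0 ?adde0//.
  exact: integrable_fin_num.
rewrite /mmt_gen_fun !unlock.
have E (V : {RV P >-> R}) :
    (\int[P]_w ((expR \o t \o* V) w)%:E = \int[P]_w (expR (t * V w))%:E)%E.
  by apply: eq_integral => w _ /=; rewrite mulrC.
have mexp (V : {RV P >-> R}) : measurable_fun [set: T] (fun w => expR (t * V w)).
  by apply: measurableT_comp => //; exact: measurable_funM.
rewrite !E.
apply: (@le_trans _ _ (\int[P]_w ((expR (t * Y w))%:E * (f w)%:E))%E).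
  apply: ae_ge0_le_integral => //.
  - exact/measurable_EFinP.
  - by move=> w _; rewrite -EFinM lee_fin mulr_ge0 ?expR_ge0.
  - by apply/measurable_EFinP; exact: measurable_funM.
  - by apply: filterS hd => w hw _; rewrite -EFinM lee_fin chord.
have mW : sub_measurable G (fun w => expR (t * Y w)).
  by apply: measurableT_comp => //; exact: measurable_funM.
rewrite (@ge0_integral_weight_eq _ _ _ P G f (cst kappa))//.
under eq_integral do rewrite muleC.
rewrite ge0_integralZl_EFin//.
exact/measurable_EFinP.
Qed.

(** Iteration of [mmt_gen_fun_step] from [Z 0 = 0], with [cosh] replaced by its
    Gaussian bound. *)
Lemma azuma_mmt_gen_fun (d : measure_display) (T : measurableType d)
    (R : realType) (P : probability T R) (F : nat -> set (set T))
    (Z : nat -> {RV P >-> R}) (a t : R) (n : nat) :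
  filtration F -> martingale F Z -> {ae P, forall w, Z 0%N w = 0} ->
  0 < a -> 0 <= t ->
  (forall n, (1 <= n)%N -> {ae P, forall w, - a <= mart_diff Z n w <= a}) ->
  ('M_P (Z n) t <= (expR ((t * a) ^+ 2 / 2) ^+ n)%:E)%E.
Proof.
move=> [sF FT _] [_ hZ] Z0 a0 t0 hd; elim: n => [|n IHn].
  rewrite expr0 /mmt_gen_fun unlock (@ae_eq_integral _ _ _ P setT (cst 1%E))//.
  - by rewrite integral_cst//= probability_setT mule1.
  - by apply/measurable_EFinP; apply: measurableT_comp => //; exact: measurable_funM.
  - by apply: filterS Z0 => w /= -> _; rewrite mul0r expR0.
apply: le_trans (mmt_gen_fun_step (sF n) (FT n) (hZ n) a0 t0 (hd n.+1 isT)) _.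
rewrite (exprS _ n) [leRHS]EFinM; apply: lee_pmul => //.
- by rewrite /mmt_gen_fun unlock; apply: integral_ge0 => w _; rewrite lee_fin expR_ge0.
- by rewrite lee_fin ler_pdivrMr// [leRHS]mulrC; exact: expRD_expRN_le.
Qed.

(** The Azuma-Hoeffding inequality at the linear level [n * c]; the power form
    of the bound makes its geometric decay explicit. *)
Lemma azuma (d : measure_display) (T : measurableType d)
    (R : realType) (P : probability T R) (F : nat -> set (set T))
    (Z : nat -> {RV P >-> R}) (a c : R) (n : nat) :
  filtration F -> martingale F Z -> {ae P, forall w, Z 0%N w = 0} ->
  0 < a -> 0 < c ->
  (forall n, (1 <= n)%N -> {ae P, forall w, - a <= mart_diff Z n w <= a}) ->
  (P [set w | (n%:R * c <= Z n w)%R] <= (expR (- (c ^+ 2 / (2 * a ^+ 2))) ^+ n)%:E)%E.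
Proof.
move=> hF hZ Z0 a0 c0 hd.
(* [c / a ^+ 2] minimizes the exponent [n * ((t * a) ^+ 2 / 2 - t * c)]. *)
have t0 : 0 < c / a ^+ 2 by rewrite divr_gt0// exprn_gt0.
apply: le_trans (chernoff (Z n) (n%:R * c) t0) _.
apply: le_trans (lee_wpmul2r _ (azuma_mmt_gen_fun n hF hZ Z0 a0 (ltW t0) hd)) _.
  by rewrite lee_fin expR_ge0.
rewrite -EFinM lee_fin -[leRHS]expRM_natl -[X in X * _]expRM_natl -expRD ler_expR.
by rewrite le_eqVlt; apply/orP; left; apply/eqP; field; lra.
Qed.

Theorem corollary2p5 (R : realType) (d : measure_display)
    (T : measurableType d) (P : probability T R)
    (F : nat -> set (set T)) (hF : filtration F)
    (Z : nat -> {RV P >-> R})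
    (hZ : martingale F Z)
    (hbnd : forall n, bounded_rv (Z n))
    (hZ0 : {ae P, forall w, Z 0%N w = 0})
    (alpha : R) (halpha : 0 < alpha)
    (hdZ : forall n, (1 <= n)%N ->
       {ae P, forall w, - alpha <= mart_diff Z n w <= alpha}) :
  forall c : R, 0 < c ->
  exists i : nat, (1 <= i)%N /\
    forall m : nat, (1 <= m)%N ->
      (P [set w | exists n : nat, (m + i <= n)%N /\ (n%:R * c <= Z n w)%R]
        <= (expR (- (m%:R * c ^+ 2) / (2 * alpha ^+ 2)))%:E)%E.
Proof.
move=> c c0; set q := expR (- (c ^+ 2 / (2 * alpha ^+ 2))).
have q01 : 0 < q < 1.
  by rewrite expR_gt0/= expR_lt1 oppr_lt0 divr_gt0 ?mulr_gt0 ?exprn_gt0.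
have [i i1 qi] : exists2 i, (1 <= i)%N & q ^+ i <= 1 - q.
  have qlim : (fun n => q ^+ n) @ \oo --> (0 : R).
    by apply: cvg_expr; rewrite ger0_norm; case/andP: q01 => /ltW.
  have q1 : 0 < 1 - q by case/andP: q01; lra.
  have [N _ hN] : \forall n \near \oo, q ^+ n <= 1 - q.
    by apply: (cvgr_le 0).
  by exists N.+1 => //; apply: hN; exact: leqnSn.
exists i; split => // m _.
apply: (@le_trans _ _ (q ^+ (m + i) / (1 - q))%:E).
  apply: (@geometric_tail_bound _ _ _ P (fun n => [set w | n%:R * c <= Z n w])) => // n.
    rewrite [X in measurable X](_ : _ = Z n @^-1` `[n%:R * c, +oo[); last first.
      by apply/seteqP; split => w /=; rewrite in_itv/= andbT.
    exact: measurable_funPTI.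
  exact: (azuma n hF hZ hZ0).
have -> : expR (- (m%:R * c ^+ 2) / (2 * alpha ^+ 2)) = q ^+ m.
  rewrite /q -[RHS]expRM_natl; congr expR; field; lra.
have q1 : 0 < 1 - q by case/andP: q01; lra.
rewrite lee_fin exprD ler_pdivrMr// ler_wpM2l// exprn_ge0//.
by case/andP: q01 => /ltW.
Qed.
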